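(* Let $n$ be a positive integer and let $S$ be a topological semigroup which contains $\mathscr{IO}_{\infty}(\mathbb{Z}^n_{\mathrm{lex}})$ as a dense discrete subsemigroup. If $I=S\setminus\mathscr{IO}_{\infty}(\mathbb{Z}^n_{\mathrm{lex}})\neq\varnothing$, then $I$ is an ideal of $S$.
   Context: $L_n=\{1,\ldots,n\}$ with its usual order; $L_n\times_{\mathrm{lex}}\mathbb{Z}$ is $L_n\times\mathbb{Z}$ with the lexicographic order: $(i,m)\leqslant(j,l)$ iff $i<j$, or $i=j$ and $m\le l$. $\mathscr{IO}_{\infty}(\mathbb{Z}^n_{\mathrm{lex}})$ is the inverse monoid of all injective partial maps $\alpha$ from $L_n\times\mathbb{Z}$ to itself that are monotone ($x\leqslant y$ in $\operatorname{dom}\alpha$ implies $(x)\alpha\leqslant(y)\alpha$) and such that both $\operatorname{dom}\alpha$ and $\operatorname{ran}\alpha$ have finite complement in $L_n\times\mathbb{Z}$; the operation is composition of partial maps written on the right, $(x)(\alpha\beta)=((x)\alpha)\beta$. A topological semigroup is a Hausdorff topological space with a jointly continuous semigroup operation. ''Contains as a dense discrete subsemigroup'' means that $\mathscr{IO}_{\infty}(\mathbb{Z}^n_{\mathrm{lex}})$ is (isomorphic to) a subsemigroup of $S$ that is dense in $S$ and whose subspace topology is discrete. Ideal means two-sided ideal. *)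

(* Defs.v *)
From HB Require Import structures.
From mathcomp Require Import all_boot all_order all_algebra.
From mathcomp Require Import all_classical topology.
Set Implicit Arguments.
Unset Strict Implicit.
Unset Printing Implicit Defensive.
Import Order.TTheory.
Local Open Scope classical_set_scope.

(* 'I_n = {0, ..., n-1} stands for L_n = {1, ..., n}; [*l] carries the
   lexicographic order. *)
Definition LZ (n : nat) := ('I_n *l int)%type.

Lemma LZ_leE n (x y : LZ n) :
  (x <= y)%O = (x.1 < y.1)%N || (x.1 == y.1) && (x.2 <= y.2)%R.
Proof.
rewrite leEprodlexi !leEord -val_eqE /=.
by case: ltngtP.
Qed.

Section PartialMaps.
Variable T : Type.
Implicit Types f : T -> option T.

Definition pdom f : set T := [set x | exists y, f x = Some y].

Definition pran f : set T := [set y | exists x, f x = Some y].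

Definition pinjective f := forall x1 x2 y,
  f x1 = Some y -> f x2 = Some y -> x1 = x2.

End PartialMaps.

Definition pmonotone d (T : porderType d) (f : T -> option T) :=
  forall x1 x2 y1 y2, f x1 = Some y1 -> f x2 = Some y2 ->
  (x1 <= x2)%O -> (y1 <= y2)%O.

Record IO_spec n (f : LZ n -> option (LZ n)) : Prop := {
  IO_inj : pinjective f;
  IO_mono : pmonotone f;
  IO_codom : finite_set (~` pdom f);
  IO_coran : finite_set (~` pran f)
}.

Record IO n := MkIO {
  IO_fun :> LZ n -> option (LZ n);
  IO_funP : IO_spec IO_fun
}.

HB.instance Definition _ n := gen_eqMixin (IO n).
HB.instance Definition _ n := gen_choiceMixin (IO n).

Section IOMonoid.
Variable n : nat.
Implicit Types a b c : IO n.

Lemma IO_eq a b : IO_fun a = IO_fun b -> a = b.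
Proof.
case: a b => [f fP] [g gP] /= fg; case: _ / fg in gP *.
by rewrite (Prop_irrelevance fP gP).
Qed.

Lemma IO_one_spec : @IO_spec n Some.
Proof.
split.
- by move=> x1 x2 y [->] [->].
- by move=> x1 x2 y1 y2 [->] [->].
- rewrite (_ : ~` _ = set0) //; apply/seteqP; split=> // x; apply.
  by exists x.
- rewrite (_ : ~` _ = set0) //; apply/seteqP; split=> // x; apply.
  by exists x.
Qed.

Definition IO_one : IO n := MkIO IO_one_spec.

(* [pcomp g f] is "f, then g": the product of a and b, for maps written on the
   right, applies a first. *)
Lemma pcompE (f g : LZ n -> option (LZ n)) x z :
  pcomp g f x = Some z <-> exists2 y, f x = Some y & g y = Some z.
Proof.
rewrite /pcomp; case fx: (f x) => [y|] /=; split=> //.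
- by exists y.
- by move=> [y' [->]].
- by move=> [].
Qed.

Lemma IO_mul_spec a b : IO_spec (pcomp b a).
Proof.
have [ai am ad ar] := IO_funP a; have [bi bm bd br] := IO_funP b.
split.
- move=> x1 x2 z /pcompE[y1 a1 b1] /pcompE[y2 a2 b2].
  by have y12 := bi _ _ _ b1 b2; subst y2; apply: ai a1 a2.
- move=> x1 x2 z1 z2 /pcompE[y1 a1 b1] /pcompE[y2 a2 b2] x12.
  exact: bm b1 b2 (am _ _ _ _ a1 a2 x12).
- apply: (@sub_finite_set _ _
    (~` pdom a `|` a @^-1` (Some @` ~` pdom b))).
    move=> x nx; case ax: (a x) => [y|]; last by left=> -[y]; rewrite ax.
    right; exists y => // -[z bz]; apply: nx; exists z.
    by apply/pcompE; exists y.
  rewrite finite_setU; split=> //; apply: finite_preimage; last first.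
    exact: finite_image.
  move=> x1 x2; rewrite inE => -[y _ ax1] _ ax12.
  by apply: (ai _ _ y); [rewrite ax1|rewrite -ax12 ax1].
- apply: (@sub_finite_set _ _
    (~` pran b `|` (fun y => odflt y (b y)) @` ~` pran a)).
    move=> z nz; have [[y bz]|nbz] := pselect (pran b z); last by left.
    right; exists y; last by rewrite bz.
    by move=> [x ax]; apply: nz; exists x; apply/pcompE; exists y.
  by rewrite finite_setU; split=> //; apply: finite_image.
Qed.

Definition IO_mul a b : IO n := MkIO (IO_mul_spec a b).

Lemma IO_mulA : associative IO_mul.
Proof.
move=> a b c; apply/IO_eq/funext => x /=; rewrite /pcomp /=.
by case: (IO_fun a x).
Qed.

Lemma IO_mul1g : left_id IO_one IO_mul.
Proof. by move=> a; apply/IO_eq/funext. Qed.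

Lemma IO_mulg1 : right_id IO_one IO_mul.
Proof.
by move=> a; apply/IO_eq/funext => x /=; rewrite /pcomp; case: (IO_fun a x).
Qed.

HB.instance Definition _ :=
  isMonoid.Build (IO n) IO_mulA IO_mul1g IO_mulg1.

End IOMonoid.

HB.mixin Record isTopologicalSemigroup S & Topological S & Semigroup S := {
  mulg_continuous : continuous (fun p : S * S => (p.1 * p.2)%g);
  topsemigroup_hausdorff : hausdorff_space S
}.

#[short(type="topologicalSemigroupType")]
HB.structure Definition TopologicalSemigroup :=
  {S of isTopologicalSemigroup S & Topological S & Semigroup S}.

(* The subset A is discrete in its subspace topology (the initial topology
   that [set_type A] gets from its inclusion in X). *)
Definition discrete_subspace (X : topologicalType) (A : set X) :=
  forall U : set (set_type A), open U.

Definition two_sided_ideal (S : semigroupType) (I : set S) :=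
  forall s x, I x -> I (s * x)%g /\ I (x * s)%g.

(* Main.v *)
(** In the monoid every equation [a * c = b] or [c * a = b] has only finitely many
    solutions [c]: the equation determines [c] off a finite set, and on
    that set injectivity leaves only finitely many values.  On the other side, the points of
    a dense discrete subset of a Hausdorff space are isolated in the whole space.
    So if [s * x] lay in the monoid with [x] outside it, then by continuity
    [u * v = s * x] for some [u] in the monoid near [s] and all [v] near [x]; but
    each neighbourhood of [x] contains infinitely many elements of the monoid. *)
Require Import Defs.
From mathcomp Require Import all_boot all_order all_algebra.
From mathcomp Require Import finmap.
From mathcomp Require Import all_classical topology.
Local Open Scope classical_set_scope.

(** Fix [f0] in [E]: every member of [E] is rebuilt from its restriction to [A], a map between
    finite sets, by taking the values of [f0] off [A]. *)
Lemma finite_set_fun {T U : choiceType} {A : set T} {B : set U}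
    {E : set (T -> U)} :
  finite_set A -> finite_set B ->
  (forall f g x, E f -> E g -> ~ A x -> f x = g x) ->
  (forall f x, E f -> A x -> B (f x)) ->
  finite_set E.
Proof.
move=> /finite_fsetP[X AX] /finite_fsetP[Y BY] Eeq EB; subst A B.
have [->|/set0P[f0 Ef0]] := eqVneq E set0; first exact: finite_set0.
pose Phi (g : {ffun X -> Y}) (x : T) : U :=
  oapp (fun u => val (g u)) (f0 x) (insub x).
apply: (@sub_finite_set _ _ (Phi @` setT)); last exact/finite_image/finite_finset.
move=> f Ef.
exists [ffun u : X => FSetSub (EB f (val u) Ef (valP u))] => //.
apply/funext => x; rewrite /Phi; case: insubP => [u _ <-|xX] /=.
  by rewrite ffunE.
by apply: Eeq => //; apply/negP.
Qed.

Section FiniteSolutions.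
Context {n : nat}.
Implicit Types a b c : IO n.

Lemma finite_IO_set {A B : set (LZ n)} {E : set (IO n)} :
  finite_set A -> finite_set B ->
  (forall c c' x, E c -> E c' -> ~ A x -> c x = c' x) ->
  (forall c x y, E c -> A x -> c x = Some y -> B y) ->
  finite_set E.
Proof.
move=> finA finB Eeq EB.
have finE : finite_set (@IO_fun n @` E).
  (* [None] is a possible value, since [c] may be undefined at points of [A]. *)
  apply: (@finite_set_fun _ _ A (None |` Some @` B)) => //.
  - by rewrite finite_setU; split; [exact: finite_set1|exact: finite_image].
  - by move=> _ _ x [c Ec <-] [c' Ec' <-]; exact: Eeq.
  - move=> _ x [c Ec <-] Ax; case cx: (c x) => [y|]; last by left.
    by right; exists y => //; exact: EB cx.
apply: sub_finite_set (finite_preimage _ finE); first by move=> c Ec; exists c.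
by move=> c c' _ _; exact: IO_eq.
Qed.

(** The equation fixes [c] on the range of [a]; by injectivity, [c] sends the other points outside
    the range of [b]. *)
Lemma finite_IO_mull a b : finite_set [set c | (a * c)%g = b].
Proof.
have [_ _ _ ar] := IO_funP a; have [_ _ _ br] := IO_funP b.
apply: (finite_IO_set ar br) => [c c' x|c y z] /=.
  move=> acb ac'b /contrapT[w aw].
  have := congr1 (fun d : IO n => d w) (etrans acb (esym ac'b)).
  by rewrite /= /pcomp aw.
move=> acb nay cy [x]; rewrite -acb => /pcompE[y' ay' cy'].
by apply: nay; exists x; rewrite (IO_inj (IO_funP c) cy cy').
Qed.

(** As [a] is injective, [c] is fixed on the domain of [b]; elsewhere its values avoid the domain of
    [a]. *)
Lemma finite_IO_mulr a b : finite_set [set c | (c * a)%g = b].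
Proof.
have [ai _ ad _] := IO_funP a; have [_ _ bd _] := IO_funP b.
apply: (finite_IO_set bd ad) => [c c' x|c x y] /=.
  move=> cab c'ab /contrapT[z bz].
  move: (bz) (bz); rewrite -{1}cab -c'ab => /pcompE[y cx ay] /pcompE[y' c'x ay'].
  by rewrite cx c'x (ai _ _ _ ay ay').
move=> cab nbx cx [z az]; apply: nbx; exists z.
by rewrite -cab; apply/pcompE; exists y.
Qed.

End FiniteSolutions.

(** Some open [U] meets [D] only in [d]; a second point of [U] would make [U] minus [d] a nonempty
    open set missing [D]. *)
Lemma dense_discrete_open1 {X : topologicalType} {D : set X} {d : X} :
  hausdorff_space X -> dense D -> discrete_subspace D -> D d -> open [set d].
Proof.
move=> hX dD discD Dd.
have [U oU UE] := discD [set SigSub (mem_set Dd)].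
have UDd x : U x -> D x -> x = d.
  move=> Ux Dx.
  have : (set_val @^-1` U) (SigSub (mem_set Dx) : set_type D) by [].
  by rewrite UE => /(congr1 val).
have Ud : U d.
  have : [set SigSub (mem_set Dd) : set_type D] (SigSub (mem_set Dd)) by [].
  by rewrite -UE.
suff -> : [set d] = U by [].
apply/seteqP; split=> [_ ->//|x Ux]; apply: contrapT => xd.
have oV : open (U `&` ~` [set d]).
  apply: openI => //; apply: closed_openC.
  exact/accessible_closed_set1/hausdorff_accessible.
have [y [[Uy yd] Dy]] := dD _ (ex_intro _ x (conj Ux xd)) oV.
exact: yd (UDd _ Uy Dy).
Qed.

(** A finite trace of [D] on [V] would be closed, and removing it from the interior of [V] would
    leave an open set around [x] missing [D]. *)
Lemma dense_infinite_nbhs {X : topologicalType} {D V : set X} {x : X} :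
  hausdorff_space X -> dense D -> ~ D x -> nbhs x V -> infinite_set (V `&` D).
Proof.
move=> hX dD nDx /nbhs_interior Vx finVD.
have cVD : closed (V `&` D).
  exact: (accessible_finite_set_closed.1 (hausdorff_accessible hX)).
have oW : open (interior V `&` ~` (V `&` D)).
  by apply: openI; [exact: open_interior|exact: closed_openC].
have [|y [[Vy nVDy] Dy]] := dD _ _ oW.
  by exists x; split; [exact: nbhs_singleton|case].
by apply: nVDy; split=> //; exact: interior_subset.
Qed.

Theorem theorem4p5 (n : nat) (n_gt0 : (0 < n)%N)
    (S : topologicalSemigroupType) (iota : {multiplicative IO n -> S})
    (iota_inj : injective iota)
    (iota_dense : dense (range iota))
    (iota_discrete : discrete_subspace (range iota)) :
  ~` range iota !=set0 -> two_sided_ideal (~` range iota).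
Proof.
move=> _ s x nDx; have hS := @topsemigroup_hausdorff S.
(* A product in the monoid is an isolated point, so multiplication is constant on a box around
   [p]. *)
have nbhs_mul (p : S * S) : range iota (p.1 * p.2)%g ->
    exists2 W : set S * set S, nbhs p.1 W.1 /\ nbhs p.2 W.2 &
      forall u v, W.1 u -> W.2 v -> (u * v = p.1 * p.2)%g.
  move=> Dp; have o1 := dense_discrete_open1 hS iota_dense iota_discrete Dp.
  have [W pW WE] := mulg_continuous p _ (open_nbhs_nbhs (conj o1 erefl)).
  by exists W => // u v Wu Wv; exact: (WE (u, v)).
have dense_nbhs (y : S) (W : set S) : nbhs y W -> exists a, W (iota a).
  move=> yW; have [|z [Wz [a _ az]]] := iota_dense _ _ (open_interior W).
    by exists y; exact: nbhs_singleton (nbhs_interior yW).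
  by exists a; rewrite az; exact: interior_subset.
split=> Dsx; have [b _ bE] := Dsx.
- have [[U V] /= [sU xV] UVE] := nbhs_mul (s, x) Dsx.
  have [a Ua] := dense_nbhs _ _ sU.
  apply: (dense_infinite_nbhs hS iota_dense nDx xV).
  (* With [iota a] fixed in [U], each [c] with [iota c] in [V] solves [a * c = b]. *)
  apply: sub_finite_set (finite_image iota (finite_IO_mull a b)).
  move=> z [Vz [c _ cz]]; exists c => //=; apply: iota_inj.
  by rewrite gmulfM bE cz; exact: UVE.
- have [[V U] /= [xV sU] VUE] := nbhs_mul (x, s) Dsx.
  have [a Ua] := dense_nbhs _ _ sU.
  apply: (dense_infinite_nbhs hS iota_dense nDx xV).
  apply: sub_finite_set (finite_image iota (finite_IO_mulr a b)).
  move=> z [Vz [c _ cz]]; exists c => //=; apply: iota_inj.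
  by rewrite gmulfM bE cz; exact: VUE.
Qed.
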